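(* Let $\Phi:\mathbb{R}\times\Omega\times X\to X$ be a measurable random dynamical system over $\theta$. If $\Phi$ has a random almost periodic solution $H:\mathbb{R}\times\Omega\to X$ with relatively dense set $\{\tau_k\}$, then it has an almost periodic probability measure $\mu:\mathbb{R}\to\mathcal{P}_P(\Omega\times X)$, $t\mapsto\mu_t$, on $(\Omega\times X,\mathcal{F}\otimes\mathcal{B}(X))$, given by: for any $f\in C_{BL}(\Omega\times X)$, $$\mu_t(f)=\int_\Omega f(\theta_t\omega,H(t,\omega))\,P(d\omega),$$ and for any $A\in\mathcal{F}\otimes\mathcal{B}(X)$, $$\mu_t(A)=\int_\Omega\delta_{H(t,\omega)}(A_{\theta_t\omega})\,P(d\omega).$$
   Context: $(\Omega,\mathcal{F},P)$ is a probability space and $\theta=(\theta_t)_{t\in\mathbb{R}}$ is a measure-preserving measurable flow on it: $\theta_0=\mathrm{Id}$, $\theta_{t+s}=\theta_t\circ\theta_s$, $(\omega,t)\mapsto\theta_t\omega$ is measurable, and each $\theta_t$ preserves $P$. $(X,d)$ is a Polish space with Borel $\sigma$-algebra $\mathcal{B}(X)$. A measurable random dynamical system on $X$ over $\theta$ is a $(\mathcal{B}(\mathbb{R})\otimes\mathcal{F}\otimes\mathcal{B}(X),\mathcal{B}(X))$-measurable map $\Phi:\mathbb{R}\times\Omega\times X\to X$ such that, writing $\Phi(t,\omega)=\Phi(t,\omega,\cdot)$, $\Phi(0,\omega)=\mathrm{id}_X$ and $\Phi(t+s,\omega)=\Phi(t,\theta_s\omega)\circ\Phi(s,\omega)$ for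 all $s,t\in\mathbb{R}$, $\omega\in\Omega$. Its skew product is $\Theta(t):\Omega\times X\to\Omega\times X$, $\Theta(t)(\omega,x)=(\theta_t\omega,\Phi(t,\omega)x)$, and for a measure $\nu$ on $\Omega\times X$, $\Theta(t)\nu$ denotes the push-forward, $\Theta(t)\nu(A)=\nu(\Theta(t)^{-1}A)$. A set $E\subset\mathbb{R}$ is relatively dense if there is $l>0$ such that every interval $[a,a+l]$, $a\in\mathbb{R}$, contains a point of $E$; a number $l(\varepsilon)$ defines a relatively dense set $\{\tau_k\}$ if this holds with $l=l(\varepsilon)$. A random almost periodic solution of $\Phi$ is an $\mathcal{F}$-measurable map $H:\mathbb{R}\times\Omega\to X$ (i.e. $\omega\mapsto H(t,\omega)$ is $\mathcal{F}$-measurable for each $t$) such that for any $\varepsilon>0$ there is a number $l(\varepsilon)$ defining a relatively dense set of numbers $\{\tau_k\}$ (depending on $\varepsilon$) such that for almost all $\omega\in\Omega$, $$\Phi(t,\theta_s\omega)H(s,\omega)=H(t+s,\omega),\qquad d(H(s+\tau_k,\omega),H(s,\theta_{\tau_k}\omega))<\varepsilon,\qquad\forall t,s\in\mathbb{R},\ \forall k.$$ Fix a constant $C_1\in\mathbb{R}^+$. $C_{BL}(\Omega\times X)$ is the set of $f\in C(\Omega\times X)$ with finite norm $\|f\|=\sup_{(\omega,x)}|f(\omega,x)|$ and $|f(\omega,x)-f(\omega,y)|\le C_1d(x,y)$ for all $\omega\in\Omega$, $x,y\in X$. Here $C(\Omega\times X)$ is the set of real continuous functions on $\Omega\times X$;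 $\Omega$ is understood to carry a topology for which these functions are $\mathcal{F}\otimes\mathcal{B}(X)$-measurable. $\mathcal{P}_P(\Omega\times X)$ is the set of probability measures on $(\Omega\times X,\mathcal{F}\otimes\mathcal{B}(X))$ with marginal $P$ on $(\Omega,\mathcal{F})$, endowed with $$\rho(\mu,\nu)=\sup\{|\mu(f)-\nu(f)|: f\in C_{BL}(\Omega\times X),\ \|f\|\le1\},$$ where $\mu(f)=\int f\,d\mu$. For $A\subset\Omega\times X$, $A_\omega=\{x:(\omega,x)\in A\}$; $\delta_x$ is the Dirac measure at $x$. A map $\mu:\mathbb{R}\to\mathcal{P}_P(\Omega\times X)$, $t\mapsto\mu_t$, is called an almost periodic probability measure on $(\Omega\times X,\mathcal{F}\otimes\mathcal{B}(X))$ if for any $\varepsilon>0$ there exists a number $l(\varepsilon)$ defining a relatively dense set of numbers $\{\tau_k\}$ such that $$\Theta(t)\mu_s=\mu_{t+s},\qquad\rho(\mu_{\tau_k+s},\mu_s)<\varepsilon,\qquad\forall t,s\in\mathbb{R},\ \forall k.$$ *)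

(* Defs.v *)
From HB Require Import structures.
From mathcomp Require Import all_boot all_order all_algebra.
From mathcomp Require Import all_classical all_reals all_analysis.
Set Implicit Arguments.
Unset Strict Implicit.
Unset Printing Implicit Defensive.
Import Order.TTheory GRing.Theory Num.Theory.
Import numFieldNormedType.Exports.
Local Open Scope classical_set_scope.
Local Open Scope ring_scope.

(* A measurable space that also carries a topology; the two structures are a
   priori unrelated. *)
#[short(type="topMeasurableType")]
HB.structure Definition TopMeasurable d :=
  { T of Topological T & Measurable d T }.

#[short(type="completeMetricType")]
HB.structure Definition CompleteMetric (R : numDomainType) :=
  { T of Metric R T & Complete T }.

Definition separable (T : topologicalType) : Prop :=
  exists2 D : set T, countable D & dense D.

Notation borel X := (g_sigma_algebraType (@open X)).

Definition relatively_dense_with (R : realType) (l : R) (E : set R) : Prop :=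
  0 < l /\ forall a : R, exists2 tau, E tau & a <= tau <= a + l.

Record measure_preserving_flow d (Omega : measurableType d) (R : realType)
    (P : probability Omega R) (theta : R -> Omega -> Omega) : Prop := {
  flow0 : forall w, theta 0 w = w ;
  flowD : forall t s w, theta (t + s) w = theta t (theta s w) ;
  flow_measurable : measurable_fun [set: Omega * R]
    (fun p => theta p.2 p.1) ;
  flow_preserving : forall t (A : set Omega), measurable A ->
    pushforward P (theta t) A = P A }.

Record measurable_rds d (Omega : measurableType d) (R : realType)
    (X : completeMetricType R) (theta : R -> Omega -> Omega)
    (Phi : R -> Omega -> X -> X) : Prop := {
  rds_measurable : measurable_fun [set: R * Omega * borel X]
    (fun p => Phi p.1.1 p.1.2 p.2 : borel X) ;
  rds0 : forall w x, Phi 0 w x = x ;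
  rdsD : forall t s w x, Phi (t + s) w x = Phi t (theta s w) (Phi s w x) }.

Definition skew_product (Omega X R : Type) (theta : R -> Omega -> Omega)
    (Phi : R -> Omega -> X -> X) (t : R) (z : Omega * X) : Omega * X :=
  (theta t z.1, Phi t z.1 z.2).

(* The relatively dense set and the exceptional null set may depend on eps, but
   neither depends on s, t or on the almost periods. *)
Definition random_almost_periodic_solution d (Omega : measurableType d)
    (R : realType) (X : completeMetricType R) (P : probability Omega R)
    (theta : R -> Omega -> Omega) (Phi : R -> Omega -> X -> X)
    (H : R -> Omega -> X) : Prop :=
  (forall t, measurable_fun [set: Omega] (H t : Omega -> borel X)) /\
  forall eps : R, 0 < eps ->
    exists (l : R) (E : set R), relatively_dense_with l E /\
      {ae P, forall w,
        (forall t s, Phi t (theta s w) (H s w) = H (t + s) w) /\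
        (forall s tau, E tau ->
           mdist (H (s + tau) w) (H s (theta tau w)) < eps)}.

Definition sup_norm (T : Type) (R : realType) (f : T -> R) : \bar R :=
  ereal_sup [set `|f z|%:E | z in [set: T]].

Definition C_BL (Omega : topologicalType) (R : realType)
    (X : completeMetricType R) (C1 : R) : set (Omega * X -> R) :=
  [set f | [/\ continuous f, (sup_norm f < +oo)%E &
    forall w x y, `|f (w, x) - f (w, y)| <= C1 * mdist x y]].

Record prob_with_marginal d (Omega : measurableType d) (R : realType)
    (X : completeMetricType R) (P : probability Omega R) := ProbWithMarginal {
  pm_val :> probability (Omega * borel X)%type R ;
  pm_marginal : forall A : set Omega, measurable A ->
    pushforward pm_val fst A = P A }.

(* The supremum is that of a nonempty subset of [0, 2] (it contains the value
   at f = 0), so that the real-valued [sup] is the actual supremum. *)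
Definition rho d (Omega : topMeasurableType d) (R : realType)
    (X : completeMetricType R) (C1 : R)
    (mu nu : probability (Omega * borel X)%type R) : R :=
  sup [set `| \int[mu]_z f z - \int[nu]_z f z | |
       f in [set f | @C_BL Omega R X C1 f /\ (sup_norm f <= 1)%E]].

Definition almost_periodic_probability_measure d (Omega : topMeasurableType d)
    (R : realType) (X : completeMetricType R) (C1 : R)
    (P : probability Omega R) (theta : R -> Omega -> Omega)
    (Phi : R -> Omega -> X -> X) (mu : R -> prob_with_marginal X P) : Prop :=
  forall eps : R, 0 < eps ->
    exists (l : R) (E : set R), relatively_dense_with l E /\
      (forall t s (A : set (Omega * borel X)), measurable A ->
         pushforward (mu s) (skew_product theta Phi t : _ -> Omega * borel X) A =
         mu (t + s) A) /\
      (forall s tau, E tau -> rho C1 (mu (tau + s)) (mu s) < eps).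

(* Main.v *)
Require Import Defs.
From HB Require Import structures.
From mathcomp Require Import all_boot all_order all_algebra.
From mathcomp Require Import all_classical all_reals all_analysis.
From mathcomp Require Import measurable_realfun.
Import Order.TTheory GRing.Theory Num.Theory.
Import numFieldNormedType.Exports.
Set Implicit Arguments.
Unset Strict Implicit.
Unset Printing Implicit Defensive.
Local Open Scope classical_set_scope.
Local Open Scope ring_scope.

(** Each [mu t] is the law of the random point [(theta t w, H t w)] of the skew
product space, [w] being drawn from [P]. Everything is then a change of
variables.

The marginal on [Omega] is the law of [theta t], which is [P] because the flow
preserves [P]. Pushing [mu s] forward by the skew product gives the law of
[(theta t (theta s w), Phi t (theta s w) (H s w))]; by the flow property and the
solution identity this point agrees with [(theta (t + s) w, H (t + s) w)] for
almost all [w], and almost everywhere equal maps have the same law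
([ae_eq_law]).

For the almost periodicity, let [tau] be an almost period of [H] and [f] a
function of [C_BL C1]. The integral of [f] against [mu (tau + s)] is the mean of
[f (theta (tau + s) w, H (tau + s) w)], and against [mu s] it is the mean of
[f (theta s w, H s w)]. In the latter, [w] may be replaced by [theta tau w], as
[theta tau] preserves [P]; this gives the mean of
[f (theta (tau + s) w, H s (theta tau w))]. The two integrands now have the same
[Omega]-coordinate, so by the Lipschitz condition they differ almost everywhere
by at most [C1] times the distance of [H (s + tau) w] to [H s (theta tau w)].
Using the almost periods of [H] for [eps / 2 / C1] bounds every such difference,
hence their supremum [rho], by [eps / 2 < eps]. *)

(** The bundled form of [pushforward P f]: [Rintegral] and [prob_with_marginal]
ask for a measure and a probability, not just a set function. *)
Definition law {d d' : measure_display} {T : measurableType d}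
    {T' : measurableType d'} {R : realType} (P : probability T R) {f : T -> T'}
    (mf : measurable_fun [set: T] f) : probability T' R :=
  distribution P (mfun_Sub (mem_set mf)).

Lemma Rintegral_law (d d' : measure_display) (T : measurableType d)
    (T' : measurableType d') (R : realType) (P : probability T R) (f : T -> T')
    (mf : measurable_fun [set: T] f) (g : T' -> R) :
  measurable_fun [set: T'] g -> P.-integrable [set: T] (EFin \o (g \o f)) ->
  \int[law P mf]_y g y = \int[P]_x g (f x).
Proof.
move=> mg ig; rewrite /Rintegral; congr fine.
rewrite (integral_pushforward mf (f := EFin \o g)) //.
exact/measurable_EFinP.
Qed.

(** The invariance of [P] enters the bound on [rho] through this substitution. *)
Lemma Rintegral_measure_preserving (d : measure_display) (T : measurableType d)
    (R : realType) (P : probability T R) (f : T -> T) (g : T -> R) :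
  measurable_fun [set: T] f ->
  (forall A, measurable A -> pushforward P f A = P A) ->
  measurable_fun [set: T] g -> P.-integrable [set: T] (EFin \o (g \o f)) ->
  \int[P]_x g (f x) = \int[P]_x g x.
Proof.
move=> mf Pf mg ig; rewrite -(Rintegral_law mf) // /Rintegral.
by congr fine; apply: eq_measure_integral => A mA _; exact: Pf.
Qed.

(** In a general target space the set where [f] and [g] agree may fail to be
measurable, so the two events are not compared on it; they are compared through
the integrals of their indicators, which see only almost everywhere classes. *)
Lemma ae_eq_law (d d' : measure_display) (T : measurableType d)
    (T' : measurableType d') (R : realType) (P : probability T R)
    (f g : T -> T') (A : set T') :
  measurable_fun [set: T] f -> measurable_fun [set: T] g -> measurable A ->
  {ae P, forall x, f x = g x} -> P (f @^-1` A) = P (g @^-1` A).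
Proof.
move=> mf mg mA fg.
have mpre h : measurable_fun [set: T] h -> measurable (h @^-1` A : set T).
  by move=> mh; rewrite -[_ @^-1` _]setTI; exact: mh.
rewrite -[f @^-1` A]setIT -[g @^-1` A]setIT -!integral_indic //; [|exact: mpre..].
apply: ae_eq_integral => //.
- exact/measurable_EFinP/measurable_indic/mpre.
- exact/measurable_EFinP/measurable_indic/mpre.
- apply: filterS fg => x fgx _ /=.
  by rewrite !indicE; rewrite (_ : (x \in f @^-1` A) = (x \in g @^-1` A)) //;
    apply/idP/idP; rewrite !inE /= fgx.
Qed.

Lemma ae_le_normr_RintegralB (d : measure_display) (T : measurableType d)
    (R : realType) (P : probability T R) (f g : T -> R) (c : R) :
  P.-integrable [set: T] (EFin \o f) -> P.-integrable [set: T] (EFin \o g) ->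
  0 <= c -> {ae P, forall x, `|f x - g x| <= c} ->
  `|\int[P]_x f x - \int[P]_x g x| <= c.
Proof.
move=> If Ig c0 fgc.
have Ifg : P.-integrable [set: T] (EFin \o (fun x => f x - g x)).
  by apply: eq_integrable (integrableB _ If Ig).
rewrite -RintegralB // -lee_fin EFin_normr_Rintegral //.
apply: (le_trans (le_abse_integral P measurableT (measurable_int P Ifg))).
apply: (@le_trans _ _ (\int[P]_x cst c%:E x)%E).
  apply: ae_ge0_le_integral => //.
  - by apply: measurableT_comp => //; exact: (measurable_int P Ifg).
  - by apply: filterS fgc => x fgx _; rewrite /= lee_fin.
by rewrite integral_cst // [X in (_ * X)%E](probability_setT P) mule1.
Qed.

Lemma sup_norm_le (T : Type) (R : realType) (f : T -> R) (z : T) :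
  (`|f z|%:E <= sup_norm f)%E.
Proof. by apply: ereal_sup_ubound; exists z. Qed.

Lemma sup_norm_lty_bounded (T : Type) (R : realType) (f : T -> R) :
  (sup_norm f < +oo)%E -> exists M : R, forall z, `|f z| <= M.
Proof.
move=> foo; exists (fine (sup_norm f)) => z.
rewrite -lee_fin fineK ?sup_norm_le // fin_numElt foo andbT.
exact: lt_le_trans (ltNyr _) (sup_norm_le _ z).
Qed.

(** The supremum of an empty set of reals would be a default value, so a
bound on [rho] needs a test function. *)
Lemma C_BL0 (Omega : topologicalType) (R : realType)
    (X : completeMetricType R) (C1 : R) :
  0 < C1 -> @C_BL Omega R X C1 (cst 0) /\
  (sup_norm (cst 0%R : Omega * X -> R) <= 1)%E.
Proof.
move=> C1_gt0.
have n1 : (sup_norm (cst 0%R : Omega * X -> R) <= 1)%E.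
  by apply: ge_ereal_sup => _ [z _ <-]; rewrite normr0 lee_fin.
split=> //; split=> [||w x y]; first exact: cst_continuous.
  exact: le_lt_trans n1 (ltry _).
by rewrite subrr normr0; apply: mulr_ge0; [exact: ltW|exact: mdist_ge0].
Qed.

Lemma rho_le (d : measure_display) (Omega : topMeasurableType d)
    (R : realType) (X : completeMetricType R) (C1 c : R)
    (mu nu : probability (Omega * borel X)%type R) :
  0 < C1 ->
  (forall f, C_BL C1 f -> `|\int[mu]_z f z - \int[nu]_z f z| <= c) ->
  rho C1 mu nu <= c.
Proof.
move=> C1_gt0 h; apply: ge_sup.
  exists `|\int[mu]_z (cst 0 z) - \int[nu]_z (cst 0 z)|, (cst 0) => //.
  exact: C_BL0.
by move=> _ [f [fC _] <-]; exact: h.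
Qed.

Theorem theorem5p2 (R : realType) (d : measure_display)
    (Omega : topMeasurableType d) (P : probability Omega R)
    (X : completeMetricType R) (C1 : R)
    (theta : R -> Omega -> Omega) (Phi : R -> Omega -> X -> X)
    (H : R -> Omega -> X)
    (hX : separable X)
    (hC1 : 0 < C1)
    (hcont : forall f : Omega * X -> R, continuous f ->
       measurable_fun [set: Omega * borel X] f)
    (htheta : measure_preserving_flow P theta)
    (hPhi : measurable_rds theta Phi)
    (hH : random_almost_periodic_solution P theta Phi H) :
  exists mu : R -> prob_with_marginal X P,
    [/\ almost_periodic_probability_measure C1 theta Phi mu,
        forall (t : R) (f : Omega * X -> R), C_BL C1 f ->
          \int[mu t]_z f z = \int[P]_w f (theta t w, H t w) &
        forall (t : R) (A : set (Omega * borel X)), measurable A ->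
          (mu t A = \int[P]_w \d_(H t w : borel X) (xsection A (theta t w)))%E].
Proof.
have mtheta t : measurable_fun [set: Omega] (theta t).
  exact: (measurable_fun_pair1 t (flow_measurable htheta)).
have [mH apH] := hH.
pose G t w : Omega * borel X := (theta t w, H t w).
have mG t : measurable_fun [set: Omega] (G t) by exact: measurable_fun_pair.
have mGA t (A : set (Omega * borel X)) :
    measurable A -> measurable (G t @^-1` A : set Omega).
  by move=> mA; rewrite -[_ @^-1` _]setTI; exact: mG.
have margG t A : measurable A -> pushforward (law P (mG t)) fst A = P A.
  by move=> mA; exact: (flow_preserving htheta t).
pose mu t : prob_with_marginal X P := ProbWithMarginal (margG t).
have integrable_comp f (g : Omega -> Omega * borel X) : C_BL C1 f ->
    measurable_fun [set: Omega] g ->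
    P.-integrable [set: Omega] (EFin \o (f \o g)).
  move=> [cf /sup_norm_lty_bounded[M fM] _] mg.
  apply: measurable_bounded_integrable => //.
  - exact: le_lt_trans (probability_le1 _ _) (ltry _).
  - exact: measurableT_comp (hcont _ cf) mg.
  - exists M; split; first exact: num_real.
    by move=> y My w _ /=; exact: le_trans (fM _) (ltW My).
have muE t f : C_BL C1 f -> \int[mu t]_z f z = \int[P]_w f (theta t w, H t w).
  move=> fC; apply: Rintegral_law; first by apply: hcont; case: fC.
  exact: integrable_comp.
exists mu; split => //.
- move=> eps eps0.
  have eps'0 : 0 < eps / 2 / C1 by rewrite !divr_gt0.
  (* Dividing by [C1] offsets the Lipschitz constant of the test functions;
     the factor 2 keeps the supremum strictly below [eps]. *)
  have [l [E [El aeH]]] := apH _ eps'0.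
  exists l, E; split => //; split.
  + move=> t s A mA.
    pose S w : Omega * borel X :=
      (theta t (theta s w), Phi t (theta s w) (H s w)).
    have mS : measurable_fun [set: Omega] S.
      apply: measurable_fun_pair; first exact: measurableT_comp.
      pose q w : R * Omega * borel X := (t, theta s w, H s w).
      have mq : measurable_fun [set: Omega] q.
        by do 2 apply: measurable_fun_pair => //.
      exact: (measurableT_comp (rds_measurable hPhi) mq).
    change (P (S @^-1` A) = P (G (t + s) @^-1` A)).
    apply: ae_eq_law => //.
    by apply: filterS aeH => w [sol _]; rewrite /S /G sol (flowD htheta).
  + move=> s tau Etau; apply: (@le_lt_trans _ _ (eps / 2)); last first.
      by rewrite ltr_pdivrMr // ltr_pMr // ltr1n.
    apply: rho_le => // f fC; rewrite !muE //.
    have mGt : measurable_fun [set: Omega] (G s \o theta tau).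
      exact: measurableT_comp.
    have <- : \int[P]_w f (G s (theta tau w)) = \int[P]_w f (G s w).
      apply: (@Rintegral_measure_preserving _ _ _ P (theta tau) (f \o G s)) => //.
      * exact: (flow_preserving htheta).
      * by apply: measurableT_comp => //; apply: hcont; case: fC.
      * exact: (integrable_comp f _ fC mGt).
    apply: ae_le_normr_RintegralB => //.
    * exact: (integrable_comp f _ fC (mG _)).
    * exact: (integrable_comp f _ fC mGt).
    * by rewrite ltW // divr_gt0.
    apply: filterS aeH => w [_ /(_ s tau Etau)/ltW Hw] /=.
    case: fC => _ _ lip.
    rewrite /G (addrC tau s) (flowD htheta) (le_trans (lip _ _ _)) //.
    by rewrite mulrC -ler_pdivlMr.
- move=> t A mA; change (mu t A) with (P (G t @^-1` A)).
  rewrite -[_ @^-1` _]setIT -integral_indic //; last exact: mGA.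
  by apply: eq_integral => w _; rewrite diracE indicE mem_xsection.
Qed.
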